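(* Let $k\ge 2$ and $n\ge 1$ be integers and let $T^n_k$ be the perfect $k$-ary tree of depth $n$. Then: \begin{itemize} \item for $n=1$, the paint cost spectrum of $T^n_k$ is $(k;\,k-1)$ and the paint cost ratio is $1$; \item for $n=2$, the paint cost spectrum of $T^n_k$ is $(k;\,k^2-1,\,k(k-1),\dots,k(k-1))$ (all entries after the entry $k^2-1$ equal $k(k-1)$), and the paint cost ratio is $\displaystyle\frac{k^2-2k+1}{k^2-2k+2}$; \item for $n\ge 3$, the paint cost spectrum of $T^n_k$ is $$(k;\;k^n-1,\;(k-1)(k^2+1)k^{n-3},\;k^{n-1}(k-1),\dots,k^{n-1}(k-1))$$ (all entries after the entry $(k-1)(k^2+1)k^{n-3}$ equal $k^{n-1}(k-1)$), and the paint cost ratio is $\displaystyle\frac{k^{n-1}(k-1)-k}{k^{n-1}(k-1)-k+2}$. \end{itemize}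
   Context: All graphs are finite and simple. For $k\ge 2$, $n\ge 1$, the perfect $k$-ary tree of depth $n$, denoted $T_k^n$, is the connected acyclic graph with $k^n$ leaves in which one vertex (the root) has degree $k$ and is at distance $n$ from every leaf, and all other internal (non-leaf) vertices have degree $k+1$. A coloring of the vertices of a graph $G$ with $d$ colors (a map from $V(G)$ to a set of $d$ colors, not required to use every color) is $d$-distinguishing if the only automorphism of $G$ preserving the color classes (i.e. mapping each color class to itself) is the trivial one. The distinguishing number $\operatorname{Dist}(G)$ is the smallest $d$ for which $G$ has a $d$-distinguishing coloring. For $d\ge \operatorname{Dist}(G)$, the paint cost of $d$-distinguishing $G$ (the $d$-paint cost), denoted $\rho^d(G)$, is the minimum size of the complement of a color class over all $d$-distinguishing colorings of $G$. A set $S\subseteq V(G)$ is a fixing set for $G$ if the only automorphism of $G$ that fixes every element of $S$ is the trivial one; the fixing number $\operatorname{Fix}(G)$ is the smallest cardinality of a fixing set. The frugal distinguishing number $\operatorname{Fdist}(G)$ is the smallest $d$ for which $\rho^d(G)=\operatorname{Fix}(G)$. The paint cost spectrum of $G$ is the list $$(\operatorname{Dist}(G);\ \rho^{\operatorname{Dist}(G)}(G),\ \rho^{\operatorname{Dist}(G)+1}(G),\ \dots,\ \rho^{\operatorname{Fix}(G)+1}(G)),$$ where the first entry is the distinguishing number and the remaining entries are the $d$-paint costs for $d=\operatorname{Dist}(G),\dots,\operatorname{Fix}(G)+1$. The paint cost ratio of $G$ is $$\frac{\operatorname{Fix}(G)-\operatorname{Fdist}(G)+2}{\operatorname{Fix}(G)-\operatorname{Dist}(G)+2}.$$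 *)

(* Defs.v *)
From HB Require Import structures.
From mathcomp Require Import all_boot all_order all_fingroup all_algebra.

Set Implicit Arguments.
Unset Strict Implicit.
Unset Printing Implicit Defensive.

Local Open Scope nat_scope.

Record sgraph : Type := SGraph {
  vertex :> finType;
  adj : rel vertex;
  adj_sym : symmetric adj;
  adj_irr : irreflexive adj }.

Section Graphs.
Variable G : sgraph.
Implicit Types (x y : G) (s : {perm G}) (S : {set G}).

Definition degree x : nat := #|[set y | adj x y]|.

Definition leaves : {set G} := [set x | degree x == 1].

Definition connected_graph : Prop := forall x y, connect (@adj G) x y.

(* Cycles of length 2 are excluded: [ucycle] also accepts [:: x; y] for an
   edge xy. *)
Definition acyclic_graph : Prop :=
  forall c : seq G, 2 < size c -> ~ ucycle (@adj G) c.

Definition at_distance x y (d : nat) : Prop :=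
  (exists2 p, path (@adj G) x p & last x p = y /\ size p = d) /\
  (forall p, path (@adj G) x p -> last x p = y -> d <= size p).

Definition automorphism s : bool :=
  [forall x, forall y, adj (s x) (s y) == adj x y].

Definition color_class d (c : {ffun G -> 'I_d}) (i : 'I_d) : {set G} :=
  [set x | c x == i].

Definition preserves_classes d (c : {ffun G -> 'I_d}) s : bool :=
  [forall i, s @: color_class c i == color_class c i].

Definition distinguishing d (c : {ffun G -> 'I_d}) : bool :=
  [forall s, automorphism s && preserves_classes c s ==> (s == 1%g)].

Definition fixing_set S : bool :=
  [forall s, automorphism s && [forall x in S, s x == x] ==> (s == 1%g)].

Lemma distinguishing_exists :
  exists d, [exists c : {ffun G -> 'I_d}, distinguishing c].
Proof.
exists #|G|; apply/existsP; exists [ffun x => enum_rank x].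
apply/forallP=> s; apply/implyP=> /andP[_ /forallP pc].
apply/eqP/permP=> x; rewrite perm1.
have: s x \in s @: color_class [ffun x => enum_rank x] (enum_rank x).
  by apply: imset_f; rewrite inE ffunE.
by rewrite (eqP (pc _)) inE ffunE => /eqP/enum_rank_inj.
Qed.

Definition Dist : nat := ex_minn distinguishing_exists.

Definition Fix : nat := #|[arg min_(S < [set: G] | fixing_set S) #|S| ]|.

(* The minimum over an empty range is the conventional value #|G|, which
   bounds the size of every complement; this occurs when d < Dist, where the
   paint cost is not meant to be used. *)
Definition paint_cost (d : nat) : nat :=
  \big[minn/#|G|]_(c : {ffun G -> 'I_d} | distinguishing c)
    \big[minn/#|G|]_(i < d) #|~: color_class c i|.

End Graphs.

Section Fdist.
Variable G : sgraph.
Implicit Types (s : {perm G}) (S : {set G}).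

Lemma fixing_setT : fixing_set [set: G].
Proof.
apply/forallP=> s; apply/implyP=> /andP[_ /forallP sx].
by apply/eqP/permP=> x; rewrite perm1; apply/eqP; have := sx x; rewrite inE.
Qed.

Lemma Fix_le S : fixing_set S -> Fix G <= #|S|.
Proof.
by move=> fS; rewrite /Fix; case: arg_minnP => [|S0 _]; [exact: fixing_setT|apply].
Qed.

Lemma Fix_attained : exists2 S : {set G}, fixing_set S & #|S| = Fix G.
Proof.
rewrite /Fix; case: arg_minnP => [|S0 fS _]; first exact: fixing_setT.
by exists S0.
Qed.

Lemma preserves_classesP d (c : {ffun G -> 'I_d}) s :
  reflect (forall x, c (s x) = c x) (preserves_classes c s).
Proof.
apply: (iffP forallP) => [pc x|cs i].
  have: s x \in s @: color_class c (c x) by apply: imset_f; rewrite inE.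
  by rewrite (eqP (pc _)) inE => /eqP.
rewrite eqEcard card_imset ?leqnn ?andbT; last exact: perm_inj.
by apply/subsetP=> _ /imsetP[x xi ->]; move: xi; rewrite !inE cs.
Qed.

Lemma fixing_set_color_classC d (c : {ffun G -> 'I_d}) i :
  distinguishing c -> fixing_set (~: color_class c i).
Proof.
move=> /forallP dc; apply/forallP=> s; apply/implyP=> /andP[As /forallP fs].
apply: (implyP (dc s)); rewrite As; apply/preserves_classesP=> x.
have fixP y : c y != i -> s y = y.
  by move=> cy; apply/eqP; have := fs y; rewrite !inE cy.
have [cx|/fixP-> //] := eqVneq (c x) i.
have [-> //|/fixP/perm_inj-> //] := eqVneq (c (s x)) i.
Qed.

Lemma Fix_le_paint_cost d : Fix G <= paint_cost G d.
Proof.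
have Fix_le_card : Fix G <= #|G| by rewrite -cardsT Fix_le ?fixing_setT.
rewrite /paint_cost; elim/big_ind: _ => // [m n|c dc]; first by rewrite leq_min => ->.
elim/big_ind: _ => // [m n|i _]; first by rewrite leq_min => ->.
exact/Fix_le/fixing_set_color_classC.
Qed.

Lemma paint_cost_le d (c : {ffun G -> 'I_d}) i :
  distinguishing c -> paint_cost G d <= #|~: color_class c i|.
Proof.
move=> dc; rewrite /paint_cost -[minn]/(@Order.min _ nat).
apply: (@leq_trans (\big[minn/#|G|]_(j < d) #|~: color_class c j|)).
  exact: (@Order.TotalTheory.bigmin_le_cond _ nat _ _ _ (fun c => distinguishing c)
    (fun c : {ffun G -> 'I_d} => \big[minn/#|G|]_(j < d) #|~: color_class c j|)).
exact: (@Order.TotalTheory.bigmin_le_cond _ nat _ _ _ xpredT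
  (fun j => #|~: color_class c j|)).
Qed.

Lemma fixing_set_coloring S : fixing_set S ->
  exists2 c : {ffun G -> 'I_#|S|.+1}, distinguishing c &
    ~: color_class c ord0 = S.
Proof.
move=> /forallP fS.
pose c := [ffun x => if x \in S then inord (index x (enum S)).+1
                     else ord0 : 'I_#|S|.+1].
have cE x : x \in S -> c x = (index x (enum S)).+1 :> nat.
  by move=> xS; rewrite ffunE xS inordK // !ltnS cardE index_mem mem_enum.
have c0 x : (c x == ord0) = (x \notin S).
  have [xS|xS] := boolP (x \in S); last by rewrite ffunE (negbTE xS) eqxx.
  by rewrite -val_eqE /= cE.
exists c; last by apply/setP=> x; rewrite !inE c0 negbK.
apply/forallP=> s; apply/implyP=> /andP[As /preserves_classesP cs].
apply: (implyP (fS s)); rewrite As; apply/forallP=> x; apply/implyP=> xS.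
have sxS : s x \in S by rewrite -[_ \in S]negbK -c0 cs c0 xS.
have := cE _ sxS; rewrite cs cE // => -[eq_idx].
by rewrite -(nth_index x (s := enum S) (x := s x)) ?mem_enum // -eq_idx
  nth_index ?mem_enum.
Qed.

Lemma Dist_le_FixS : Dist G <= (Fix G).+1.
Proof.
have [S fS <-] := Fix_attained; have [c dc _] := fixing_set_coloring fS.
by rewrite /Dist; case: ex_minnP => d _; apply; apply/existsP; exists c.
Qed.

Lemma paint_cost_FixS : paint_cost G (Fix G).+1 = Fix G.
Proof.
apply/eqP; rewrite eqn_leq Fix_le_paint_cost andbT.
have [S fS <-] := Fix_attained; have [c dc cS] := fixing_set_coloring fS.
by rewrite -[X in _ <= X](congr1 (fun A : {set G} => #|A|) cS) paint_cost_le.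
Qed.

Lemma Fdist_exists : exists d, (Dist G <= d) && (paint_cost G d == Fix G).
Proof. by exists (Fix G).+1; rewrite Dist_le_FixS paint_cost_FixS eqxx. Qed.

Definition Fdist : nat := ex_minn Fdist_exists.

(* The semicolon separating the first entry is rendered by the outer pair. *)
Definition paint_cost_spectrum : nat * seq nat :=
  (Dist G, [seq paint_cost G d | d <- index_iota (Dist G) (Fix G).+2]).

Definition paint_cost_ratio : rat :=
  (((Fix G)%:R - Fdist%:R + 2%:R) / ((Fix G)%:R - (Dist G)%:R + 2%:R))%R.

End Fdist.

Definition perfect_tree (k n : nat) (T : sgraph) : Prop :=
  [/\ connected_graph T, acyclic_graph T, #|leaves T| = k ^ n
    & exists root : T,
        [/\ degree root = k,
            forall x, x \in leaves T -> at_distance root x n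
          & forall x, x != root -> x \notin leaves T -> degree x = k.+1]].

(* A model of [perfect_tree]: words of length at most n over 'I_k, where the
   parent of a nonempty word is its tail. *)
Section WordTree.
Variables k n : nat.
Hypotheses (k2 : 2 <= k) (n1 : 1 <= n).

Local Notation word := {bseq n of 'I_k}.
Implicit Types u v : word.

Definition is_parent u v := (0 < size v) && (behead v == u :> seq _).

Definition word_adj u v := is_parent u v || is_parent v u.

Lemma is_parent_size u v : is_parent u v -> size v = (size u).+1.
Proof. by case/andP=> v0 /eqP <-; rewrite size_behead prednK. Qed.

Lemma word_adj_sym : symmetric word_adj.
Proof. by move=> u v; rewrite /word_adj orbC. Qed.

Lemma word_adj_irr : irreflexive word_adj.
Proof.
by move=> u; apply/negP=> /orP[] /is_parent_size/eqP; rewrite ltn_eqF.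
Qed.

Definition word_tree := SGraph word_adj_sym word_adj_irr.

Lemma is_parent_inj u u' v : is_parent u v -> is_parent u' v -> u = u'.
Proof. by case/andP=> _ /eqP uE /andP[_ /eqP u'E]; apply: val_inj; rewrite /= -uE u'E. Qed.

Lemma word_adj_le u v : word_adj u v -> size u <= size v -> is_parent u v.
Proof. by case/orP=> // /is_parent_size ->; rewrite ltnn. Qed.

Definition nilw : word := insub_bseq n [::].

Lemma size_nilw : size nilw = 0. Proof. by rewrite /= val_insubd. Qed.

Definition parentw u : word := insub_bseq n (behead u).

Lemma parentwP u : 0 < size u -> is_parent (parentw u) u.
Proof.
move=> u0; rewrite /is_parent u0 /= val_insubd size_behead.
by rewrite (leq_trans (leq_pred _) (size_bseq u)) eqxx.
Qed.

Definition childw u (i : 'I_k) : word := insub_bseq n (i :: u).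

Lemma val_childw u i : size u < n -> childw u i = i :: u :> seq _.
Proof. by move=> un; rewrite /= val_insubd /= un. Qed.

Lemma size0_nilw u : size u = 0 -> u = nilw.
Proof. by move=> u0; apply: val_inj; rewrite /= (size0nil u0) (size0nil size_nilw). Qed.

Lemma children_card u : size u < n -> #|[set v | is_parent u v]| = k.
Proof.
move=> un; rewrite -[RHS]card_ord -(card_imset predT (f := childw u)); last first.
  by move=> i j /(congr1 val); rewrite /= !val_childw // => -[].
apply: eq_card => v; rewrite inE; apply/idP/imsetP => [/andP[v0 /eqP bv]|[i _ ->]].
  case: v v0 bv => -[//|i s] /= sv _ bs; exists i => //; apply: val_inj.
  by rewrite /= val_childw // bs.
by rewrite /is_parent val_childw /=.
Qed.

Lemma degreeE u : @degree word_tree u = (if size u < n then k else 0) + (0 < size u).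
Proof.
have -> : @degree word_tree u =
    #|[set v | is_parent u v] :|: [set v | is_parent v u]|.
  by apply: eq_card => v; rewrite !inE.
rewrite cardsU (_ : _ :&: _ = set0) ?cards0 ?subn0; last first.
  apply/setP=> v; rewrite !inE; apply/negP=> /andP[/is_parent_size su].
  by move/is_parent_size/eqP; rewrite su ltn_eqF.
congr (_ + _).
  case: ltnP => [/children_card //|nu]; apply: eq_card0 => v; rewrite inE.
  by apply/negP=> /is_parent_size sv; have := size_bseq v; rewrite sv ltnNge nu.
case: posnP => [u0|u0]; first by apply: eq_card0 => v; rewrite inE /is_parent u0.
rewrite -[RHS](cards1 (parentw u)); apply: eq_card => v; rewrite !inE.
apply/idP/eqP => [pv|->]; last exact: parentwP.
exact: is_parent_inj pv (parentwP u0).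
Qed.

Lemma leavesE u : (u \in leaves word_tree) = (size u == n).
Proof.
rewrite inE degreeE; case: ltnP => [un|nu].
  rewrite (ltn_eqF un); apply/gtn_eqF.
  exact: leq_trans k2 (leq_addr _ _).
have -> : size u = n by apply/eqP; rewrite eqn_leq size_bseq.
by rewrite eqxx n1.
Qed.

Lemma path_from_root u :
  exists2 p, path word_adj nilw p & last nilw p = u /\ size p = size u.
Proof.
have [m] := ubnP (size u); elim: m u => // m IHm u um.
have [/size0_nilw->|u0] := posnP (size u); first by exists [::]; rewrite ?size_nilw.
have pu := parentwP u0; have su := is_parent_size pu.
have [|p pp [lp sp]] := IHm (parentw u); first by move: um; rewrite su.
exists (rcons p u); first by rewrite rcons_path pp lp /word_adj pu.
by rewrite last_rcons size_rcons sp su.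
Qed.

Lemma word_tree_perfect : perfect_tree k n word_tree.
Proof.
have conn u : connect word_adj nilw u.
  by have [p pp [lp _]] := path_from_root u; apply/connectP; exists p.
split.
- move=> u v; apply: connect_trans (conn v).
  by rewrite (sym_connect_sym word_adj_sym) conn.
- move=> c c2 uc.
  have [v0 v0c] : exists v0, v0 \in c by case: c c2 {uc} => // v0 c; exists v0; exact: mem_head.
  case: (arg_maxnP (P := [in c]) (fun v : word => size v) v0c) => v vc vmax.
  have [i c' rc] := rot_to vc.
  have : ucycle word_adj (rot i c) by rewrite /ucycle rot_cycle rot_uniq.
  have : 2 < size (rot i c) by rewrite size_rot.
  have mem u : u \in rot i c -> size u <= size v by rewrite mem_rot; exact: vmax.
  move: mem; rewrite rc; case: c' {rc} => [//|a p].
  case: (lastP p) => [//|q b] mem _ /andP[/=/andP[va]].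
  rewrite rcons_path last_rcons => /andP[_ bv] /andP[_ /andP[+ _]].
  have pa : is_parent a v.
    by apply: word_adj_le; rewrite 1?word_adj_sym // mem // !inE eqxx orbT.
  have pb : is_parent b v.
    by apply: word_adj_le => //; rewrite mem // !inE mem_rcons inE eqxx !orbT.
  by rewrite (is_parent_inj pa pb) mem_rcons mem_head.
- rewrite -[k in RHS]card_ord -card_tuple -(card_imset predT (f := @bseq_of_tuple n _)); last first.
    by move=> t t' /(congr1 val) tt; apply: val_inj.
  apply: eq_card => u; rewrite leavesE; apply/idP/imsetP => [/eqP un|[t _ ->]].
    by exists (tcast un (in_tuple u)) => //; apply: val_inj; rewrite /= val_tcast.
  by rewrite size_tuple.
- exists nilw; split.
  + by rewrite degreeE size_nilw n1 addn0.
  + move=> u; rewrite leavesE => /eqP un; split.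
      by have [p pp [lp sp]] := path_from_root u; exists p; rewrite // -un.
    have grow p w : path word_adj w p -> size (last w p) <= size w + size p.
      elim: p w => [|v p IHp] w; first by rewrite addn0.
      move=> /andP[wv /IHp] /leq_trans; apply.
      rewrite [size (v :: p)]/= addnS -addSn leq_add2r.
      case/orP: wv => /is_parent_size -> //; exact: leq_trans (leqnSn _) (leqnSn _).
    move=> p pp lp; rewrite -un -lp -[size p]add0n -size_nilw; exact: grow.
  + move=> u unil; rewrite leavesE degreeE => un.
    have u0 : 0 < size u.
      by rewrite lt0n; apply: contraNneq unil => /size0_nilw ->.
    by rewrite u0 ltn_neqAle un size_bseq addn1.
Qed.

End WordTree.

Lemma perfect_tree_exists (k n : nat) :
  2 <= k -> 1 <= n -> exists T : sgraph, perfect_tree k n T.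
Proof. by move=> k2 n1; exists (word_tree k n); exact: word_tree_perfect. Qed.

(* Main.v *)
Require Import Defs.
From mathcomp Require Import all_boot all_order all_fingroup all_algebra.
From mathcomp Require Import zify ring lra.
Import GRing.Theory Num.Theory.

(* A coloring of the perfect tree is distinguishing iff, at every vertex, the
   colored subtrees hanging from the k children are pairwise non-isomorphic.
   The cost of a coloring counts the vertices that avoid a given color a.
   - With k colors, the children of each vertex must carry all the k colors, so
     every distinguishing coloring has the same cost up to the color of the root.
   - A vertex of height 1 has at most one leaf colored a, hence the lower bound
     (k - 1) k^(n-1). With k + 2 colors this bound is reached by at least k + 1
     isomorphism types at height 1, and k + 1 types at one height yield k + 1
     types at the next: leave out one of them.
   - With k + 1 colors, the bound is reached by k types at height 1, and therefore
     by a single one at height 2. At height 3, k - 1 of the k children thus cost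
     at least one more, and enough types of cost one more exist. *)

Set Implicit Arguments.
Unset Strict Implicit.
Unset Printing Implicit Defensive.

(** * The recursive model of the tree, its rooted automorphisms and its colorings *)

Section Model.
Variable k : nat.

(** [None] is the root and [Some (i, x)] is the vertex [x] of the [i]-th branch. *)
Fixpoint ktree (h : nat) : finType :=
  if h is h'.+1 then option ('I_k * ktree h')%type else unit.

Definition kroot h : ktree h :=
  match h with 0 => tt | _.+1 => None end.

Fixpoint kadj h : rel (ktree h) :=
  match h return rel (ktree h) with
  | 0 => fun _ _ => false
  | h'.+1 => fun x y =>
    match x, y with
    | None, None => false
    | None, Some (_, y') => y' == kroot h'
    | Some (_, x'), None => x' == kroot h'
    | Some (i, x'), Some (j, y') => (i == j) && kadj x' y'
    end
  end.

Lemma kconnect h (x : ktree h) : connect (@kadj h) (kroot h) x.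
Proof.
elim: h x => [|h IH] [] //; try exact: connect0.
move=> [i x]; pose f (y : ktree h) : ktree h.+1 := Some (i, y).
apply: (@connect_trans _ _ (f (kroot h))); first by apply: connect1 => /=.
have /connectP[p pp ->] := IH x; apply/connectP; exists (map f p).
  by rewrite path_map; apply: sub_path pp => u v /=; rewrite eqxx.
by rewrite last_map.
Qed.

(** Fixing the root is required outright, so that the decomposition along the branches needs no
    degree argument. *)
Definition kaut h (s : {perm ktree h}) :=
  s (kroot h) = kroot h /\ forall x y, kadj (s x) (s y) = kadj x y.

Lemma kaut1 h : kaut (1%g : {perm ktree h}).
Proof. by split=> [|x y]; rewrite !perm1. Qed.

Lemma kautV h (s : {perm ktree h}) : kaut s -> kaut s^-1%g.
Proof.
move=> [s0 sA]; split; first by rewrite -{1}s0 permK.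
by move=> x y; rewrite -sA !permKV.
Qed.

Lemma kaut_node h (p : {perm 'I_k}) (f : 'I_k -> {perm ktree h}) :
  (forall i, kaut (f i)) ->
  exists2 s : {perm ktree h.+1}, kaut s &
    forall i x, s (Some (i, x)) = Some (p i, f i x).
Proof.
move=> fA.
pose g (x : ktree h.+1) : ktree h.+1 :=
  if x is Some (i, x') then Some (p i, f i x') else None.
have gI : injective g.
  move=> [[i x]|] [[j y]|] //= [/perm_inj ij]; rewrite ij => /perm_inj xy.
  by rewrite xy.
exists (perm gI); last by move=> i x; rewrite permE.
split; first by rewrite permE.
move=> x y; rewrite !permE; case: x y => [[i x]|] [[j y]|] //=.
- rewrite (inj_eq perm_inj); case: eqP => //= ->.
  by rewrite (proj2 (fA j)).
- by rewrite -{1}(proj1 (fA i)) (inj_eq perm_inj).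
- by rewrite -{1}(proj1 (fA j)) (inj_eq perm_inj).
Qed.

(** An edge that avoids the root stays inside a branch, and branches are connected, so the branch
    containing [s (Some (i, x))] depends on [i] alone. With [kaut_node], this describes the
    automorphisms at height [h.+1] as a wreath product. *)
Lemma kaut_decompose h (s : {perm ktree h.+1}) : kaut s ->
  exists (p : {perm 'I_k}) (f : 'I_k -> {perm ktree h}),
    (forall i, kaut (f i)) /\ forall i x, s (Some (i, x)) = Some (p i, f i x).
Proof.
move=> [/= s0 sA].
pose b (i0 : 'I_k) (x : ktree h.+1) : 'I_k := if x is Some (i, _) then i else i0.
pose t (x : ktree h.+1) : ktree h := if x is Some (_, y) then y else kroot h.
have sS i x : s (Some (i, x)) <> None by rewrite -s0 => /perm_inj.
have sN i x : s (Some (i, x)) = Some (b i (s (Some (i, x))), t (s (Some (i, x)))).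
  by case E: (s _) => [[j y]|] //=; case: (sS _ _ E).
pose p i := b i (s (Some (i, kroot h))).
pose f i x := t (s (Some (i, x))).
have sE i x : s (Some (i, x)) = Some (p i, f i x).
  rewrite sN; congr (Some (_, _)); rewrite /p.
  have /connectP[q + ->] := kconnect x.
  elim/last_ind: q => [//|q y IH]; rewrite rcons_path last_rcons => /andP[/IH <- yq].
  have := sA (Some (i, last (kroot h) q)) (Some (i, y)).
  by rewrite (sN i (last _ q)) (sN i y) /= eqxx yq => /andP[/eqP ->].
have f0 i : f i (kroot h) = kroot h.
  by have /= := sA None (Some (i, kroot h)); rewrite s0 sE /= eqxx => /eqP.
have pI : injective p.
  move=> i j pij; suff: s (Some (i, kroot h)) = s (Some (j, kroot h)).
    by move/perm_inj => [].
  by rewrite !sE pij !f0.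
have fI i : injective (f i).
  move=> x y fxy; suff: s (Some (i, x)) = s (Some (i, y)) by move/perm_inj => [].
  by rewrite !sE fxy.
exists (perm pI), (fun i => perm (@fI i)); split; last first.
  by move=> i x; rewrite sE !permE.
move=> i; split; first by rewrite permE f0.
move=> x y; have /= := sA (Some (i, x)) (Some (i, y)).
by rewrite !sE /= !eqxx !permE.
Qed.

Section Colorings.
Variable C : eqType.

Definition ciso h (c c' : ktree h -> C) :=
  exists2 s : {perm ktree h}, kaut s & forall x, c' (s x) = c x.

Definition rigid h (c : ktree h -> C) :=
  forall s : {perm ktree h}, kaut s -> (forall x, c (s x) = c x) -> s = 1%g.

Definition branch h (c : ktree h.+1 -> C) i : ktree h -> C :=
  fun x => c (Some (i, x)).

Lemma ciso_root h (c c' : ktree h -> C) :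
  ciso c c' -> c (kroot h) = c' (kroot h).
Proof. by case=> s [s0 _] /(_ (kroot h)); rewrite s0. Qed.

Lemma ciso_nodeP h (c c' : ktree h.+1 -> C) :
  ciso c c' <-> c None = c' None /\
    exists p : {perm 'I_k}, forall i, ciso (branch c i) (branch c' (p i)).
Proof.
split=> [cc'|[c0 [p pP]]].
  split; first exact: ciso_root cc'.
  case: cc' => s /kaut_decompose[p [f [fA sE]]] cs.
  exists p => i; exists (f i) => // x; rewrite /branch -cs; congr c'.
  by rewrite sE.
have [f fA fP] := fin_all_exists2 pP.
have [s sA sE] := kaut_node p fA.
exists s => // -[[i x]|]; last by case: sA => /= ->.
by rewrite sE; exact: fP.
Qed.

(** A nontrivial color-preserving automorphism either moves a branch onto another one, which is then
    isomorphic to it, or acts nontrivially inside a branch. Conversely, both kinds of symmetry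
    extend to the whole tree. *)
Lemma rigid_nodeP h (c : ktree h.+1 -> C) :
  rigid c <-> (forall i, rigid (branch c i)) /\
    forall i j, ciso (branch c i) (branch c j) -> i = j.
Proof.
split=> [rc|[rb nb] s sA cs].
  split.
    move=> i t tA ct.
    pose f (j : 'I_k) := if j == i then t else 1%g.
    have fA j : kaut (f j) by rewrite /f; case: eqP => // _; exact: kaut1.
    have [s sA sE] := kaut_node 1%g fA.
    have s1 : s = 1%g.
      apply: rc => // -[[j x]|]; last by case: sA => /= ->.
      rewrite sE perm1 /f; case: eqP => [->|_]; last by rewrite perm1.
      exact: ct.
    apply/permP=> x; have := sE i x; rewrite s1 !perm1 /f eqxx.
    by case.
  move=> i j [t tA ct]; apply/eqP; case: eqP => // /eqP ij.
  (* [t] carries branch [i] to branch [j], and its inverse brings [j] back to [i]. *)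
  pose f (l : 'I_k) := if l == i then t else if l == j then t^-1%g else 1%g.
  have fA l : kaut (f l).
    rewrite /f; case: eqP => // _; case: eqP => // _; last exact: kaut1.
    exact: kautV.
  have [s sA sE] := kaut_node (tperm i j) fA.
  have s1 : s = 1%g.
    apply: rc => // -[[l x]|]; last by case: sA => /= ->.
    rewrite sE /f; case: tpermP => [->|->|]; rewrite ?eqxx.
    - exact: ct.
    - rewrite eq_sym (negbTE ij).
      by have := ct (t^-1%g x); rewrite permKV.
    - by move=> /eqP/negbTE -> /eqP/negbTE ->; rewrite perm1.
  by have := sE i (kroot h); rewrite s1 perm1 tpermL => -[ij']; rewrite ij' eqxx in ij.
have [p [f [fA sE]]] := kaut_decompose sA.
have p1 i : p i = i.
  apply/esym/nb; exists (f i) => // x; rewrite /branch -[RHS]cs; congr c.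
  by rewrite sE.
have f1 i : f i = 1%g.
  apply: rb => // x; rewrite /branch -[RHS]cs; congr c.
  by rewrite sE p1.
apply/permP=> -[[i x]|]; last by rewrite perm1; case: sA.
by rewrite sE p1 f1 !perm1.
Qed.

Lemma ciso0 (c c' : ktree 0 -> C) : c tt = c' tt -> ciso c c'.
Proof.
move=> cc'; exists 1%g; first exact: kaut1.
by move=> x; rewrite perm1; case: x.
Qed.

Lemma rigid0 (c : ktree 0 -> C) : rigid c.
Proof. by move=> s _ _; apply/permP => x; rewrite perm1; case: (s x); case: x. Qed.

Definition cost (a : C) h (c : ktree h -> C) := #|[set x | c x != a]|.

Lemma cost_sum a h (c : ktree h -> C) : cost a c = \sum_(x : ktree h) (c x != a).
Proof.
rewrite /cost -sum1_card big_mkcond; apply: eq_bigr => x _.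
by rewrite inE; case: eqP.
Qed.

Lemma cost_node a h (c : ktree h.+1 -> C) :
  cost a c = (c None != a) + \sum_(i < k) cost a (branch c i).
Proof.
under eq_bigr => i _ do rewrite cost_sum.
rewrite cost_sum (bigD1 (None : ktree h.+1)) //=; congr (_ + _).
rewrite (reindex_omap (Some : 'I_k * ktree h -> ktree h.+1) id) /=; last by case.
rewrite pair_bigA; apply: eq_big => [x|[i x] _]; last by [].
by rewrite eqxx.
Qed.

Lemma cost0 a (c : ktree 0 -> C) : cost a c = (c tt != a).
Proof. by rewrite cost_sum (bigD1 tt) //= big1 ?addn0 //; case. Qed.

End Colorings.
End Model.

(** * Vertices of the model as words *)

Section Words.
Variable k : nat.

(* The letter chosen at the root comes last, so that the parent of a nonempty
   word is its tail. *)
Fixpoint kword h : ktree k h -> seq 'I_k :=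
  match h return ktree k h -> seq 'I_k with
  | 0 => fun _ => [::]
  | h'.+1 => fun x => if x is Some (i, y) then rcons (kword y) i else [::]
  end.

Lemma size_kword h (x : ktree k h) : size (kword x) <= h.
Proof. by elim: h x => [|h IH] // [[i x]|] //=; rewrite size_rcons ltnS. Qed.

Lemma kword_inj h : injective (@kword h).
Proof.
elim: h => [|h IH] /= => [[] [] //|].
move=> [[i x]|] [[j y]|] //=.
- by move/rcons_inj => [/IH -> ->].
- by move/(congr1 size); rewrite size_rcons.
- by move/(congr1 size); rewrite size_rcons.
Qed.

Lemma kword_nil h (x : ktree k h) : (kword x == [::]) = (x == kroot k h).
Proof.
rewrite -(inj_eq (@kword_inj h)); congr (_ == _).
by case: h x.
Qed.

Lemma kword_surj h w : size w <= h -> exists x : ktree k h, kword x = w.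
Proof.
elim: h w => [|h IH] w.
  by rewrite leqn0 => /nilP ->; exists tt.
case/lastP: w => [_|w i]; first by exists None.
by rewrite size_rcons ltnS => /IH[x <-]; exists (Some (i, x)).
Qed.

Definition wparent (u v : seq 'I_k) := (v != [::]) && (behead v == u).

(** The recursion of [kadj] strips the last letter while parenthood strips the first; the two are
    compatible except on words of one letter, the neighbours of the root. *)
Lemma kadjE h (x y : ktree k h) :
  kadj x y = wparent (kword x) (kword y) || wparent (kword y) (kword x).
Proof.
have rcons0 (w : seq 'I_k) i : (rcons w i == [::]) = false by case: w.
have wpr u v i j : wparent (rcons u i) (rcons v j) = (i == j) && wparent u v.
  rewrite /wparent rcons0 /=; case: v => [|a v] /=.
    by rewrite andbF eq_sym rcons0.
  by rewrite eqseq_rcons andbC eq_sym.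
have wp1 v i : wparent [::] (rcons v i) = (v == [::]).
  by rewrite /wparent rcons0; case: v => [|a v] /=; rewrite ?eqxx // rcons0.
elim: h x y => [|h IH] //= [[i x]|] [[j y]|] //=.
- by rewrite !wpr IH (eq_sym j); case: eqP.
- by rewrite wp1 kword_nil.
- by rewrite wp1 kword_nil orbF.
Qed.
End Words.

(** * Every perfect tree is isomorphic to the model *)

Section PerfectTree.
Variables (k n : nat) (T : sgraph) (r : T).
Hypotheses (k1 : 1 < k) (conn : connected_graph T).
Hypothesis leavesT : #|leaves T| = k ^ n.
Hypothesis degr : degree r = k.
Hypothesis distT : forall x, x \in leaves T -> at_distance r x n.
Hypothesis degT : forall x, x != r -> x \notin leaves T -> degree x = k.+1.

(** At the start of a walk, [p] and [v] are both the root; as it is not adjacent to itself, no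
    neighbour is excluded. *)
Definition childs (p v : T) : {set T} := [set y | adj v y & y != p].

(* [walk w] is the pair of the last two vertices met when following [w]. Until
   walks are known to be geodesic, one might revisit the root, which has one
   child less when entered from a neighbour; hence the default value of
   [nth]. *)
Fixpoint walk (w : seq 'I_k) : T * T :=
  if w is i :: w' then
    let: (p, v) := walk w' in
    let s := enum (childs p v) in (v, nth (head v s) s i)
  else (r, r).

Definition par w := (walk w).1.
Definition cur w := (walk w).2.

Lemma cur_cons i w :
  cur (i :: w) = let s := enum (childs (par w) (cur w)) in nth (head (cur w) s) s i.
Proof. by rewrite /par /cur /=; case: (walk w). Qed.

Lemma par_behead w : par w = cur (behead w).
Proof. by case: w => [|i w] //; rewrite /par /cur /=; case: (walk w). Qed.

Definition reach (x y : T) m :=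
  exists2 p, path (@adj T) x p & last x p = y /\ size p = m.

Lemma reach_cat x y z m1 m2 : reach x y m1 -> reach y z m2 -> reach x z (m1 + m2).
Proof.
move=> [p pp [lp <-]] [q qq [lq <-]]; exists (p ++ q).
  by rewrite cat_path pp lp.
by rewrite last_cat lp size_cat.
Qed.

Lemma reach1 x y : adj x y -> reach x y 1.
Proof. by move=> xy; exists [:: y]; rewrite //= xy. Qed.

Lemma leaf_far x m : x \in leaves T -> reach r x m -> n <= m.
Proof. by move=> /distT[_ H] [p pp [lp <-]]; apply: H. Qed.

Lemma near_nleaf x m : reach r x m -> m < n -> x \notin leaves T.
Proof. by move=> rx mn; apply/negP => /leaf_far /(_ rx); rewrite leqNgt mn. Qed.

Lemma card_childs v p : v \notin leaves T -> v != r -> adj v p -> #|childs p v| = k.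
Proof.
move=> vl vr vp; have := degT vr vl.
rewrite /degree (cardsD1 p) inE vp => -[<-].
by apply: eq_card => y; rewrite !inE andbC.
Qed.

Lemma card_childs_root : #|childs r r| = k.
Proof.
rewrite -degr; apply: eq_card => y; rewrite !inE.
by case: eqP => [->|_]; rewrite ?andbT ?adj_irr.
Qed.

(** Positivity lets every walk go on: even a root entered from a neighbour keeps [k - 1 > 0]
    children. The upper bound lets the letters reach all the children. *)
Lemma card_childs_bounds v p : v \notin leaves T ->
  (if v == r then true else adj v p) -> 0 < #|childs p v| <= k.
Proof.
move=> vl; case: (eqVneq v r) => [-> _|vr vp]; last first.
  by rewrite card_childs // leqnn ltnW.
have sub : childs p r \subset [set y | adj r y].
  by apply/subsetP=> y; rewrite !inE => /andP[].
have := subset_leq_card sub; rewrite -/(degree r) degr => ->; rewrite andbT.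
have : #|[set y | adj r y] :\ p| <= #|childs p r|.
  by apply/subset_leq_card/subsetP => y; rewrite !inE andbC.
have := cardsD1 p [set y | adj r y]; rewrite -/(degree r) degr.
move: k1; case: (p \in _); lia.
Qed.

Lemma nth_childs_mem p v i :
  0 < #|childs p v| -> (let s := enum (childs p v) in nth (head v s) s i) \in childs p v.
Proof.
rewrite -mem_enum cardE; case: (enum _) => [|a s] // _; change (nth a (a :: s) i \in a :: s).
case: (ltnP i (size (a :: s))) => [/mem_nth -> //|/(nth_default _) ->].
exact: mem_head.
Qed.

(** A walk shorter than [n] does not end at a leaf, and the edge back to its predecessor gives the
    bounds on its children; hence it can be extended. So both claims are proved together. *)
Lemma cur_reach_adj w : size w <= n ->
  reach r (cur w) (size w) /\ (w != [::] -> adj (cur w) (par w)).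
Proof.
elim: w => [|i w IH] /= sw; first by split=> //; exists [::].
have {IH}[rw aw] := IH (ltnW sw).
have c0 : 0 < #|childs (par w) (cur w)|.
  have [|//] := andP (@card_childs_bounds (cur w) (par w) (near_nleaf rw sw) _).
  by case: w rw aw sw => [|j w] rw aw sw; rewrite ?eqxx // aw //; case: ifP.
have := nth_childs_mem i c0; rewrite -cur_cons inE => /andP[cw _].
by rewrite par_behead adj_sym cw -addn1; split=> //; apply: reach_cat (reach1 cw).
Qed.

Lemma cur_reach w : size w <= n -> reach r (cur w) (size w).
Proof. by case/cur_reach_adj. Qed.

Lemma adj_par w : size w <= n -> w != [::] -> adj (cur w) (par w).
Proof. by case/cur_reach_adj. Qed.

Lemma adj_cur i w : size w < n -> adj (cur w) (cur (i :: w)).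
Proof.
by move=> sw; have := adj_par (w := i :: w) sw isT; rewrite par_behead adj_sym.
Qed.

Lemma cur_nleaf w : size w < n -> cur w \notin leaves T.
Proof. by move=> sw; exact: near_nleaf (cur_reach (ltnW sw)) sw. Qed.

Lemma card_childs_cur w : size w < n -> #|childs (par w) (cur w)| <= k.
Proof.
move=> sw; have [_ aw] := cur_reach_adj (ltnW sw).
have [|//] := andP (@card_childs_bounds (cur w) (par w) (cur_nleaf sw) _).
by case: w aw sw => [|j w] aw sw; rewrite ?eqxx // aw //; case: ifP.
Qed.

Lemma childs_cur w y : size w < n -> y \in childs (par w) (cur w) ->
  exists i, cur (i :: w) = y.
Proof.
move=> sw yc.
have yk : index y (enum (childs (par w) (cur w))) < k.
  by apply: leq_trans (card_childs_cur sw); rewrite cardE index_mem mem_enum.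
by exists (Ordinal yk); rewrite cur_cons /= nth_index // mem_enum.
Qed.

(** A geodesic never steps back to the predecessor, which has a shorter walk from the root; so each
    step goes to a child and is given by a letter. *)
Lemma geodesic_cur p : path (@adj T) r p -> size p <= n ->
  (forall m, reach r (last r p) m -> size p <= m) ->
  exists2 w, size w = size p & cur w = last r p.
Proof.
elim/last_ind: p => [|q y IH]; first by exists [::].
rewrite rcons_path last_rcons size_rcons => /andP[pq qy] sq geo.
have [m rm|w wq cw] := IH pq (ltnW sq).
  by rewrite -ltnS -(addn1 m); apply/geo/(reach_cat rm)/reach1.
rewrite -cw in qy; rewrite -wq in sq geo.
have [|i <-] := childs_cur (y := y) sq; last by exists (i :: w); rewrite //= wq.
rewrite inE qy; apply/eqP=> yE; have sb : size (behead w) <= size w.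
  by rewrite size_behead leq_pred.
have := cur_reach (leq_trans sb (ltnW sq)); rewrite -par_behead -yE => /geo.
by rewrite ltnNge sb.
Qed.

Lemma leaf_cur x : x \in leaves T -> exists t : n.-tuple 'I_k, cur t = x.
Proof.
move=> xl; have [[p pp [lp sp]] _] := distT xl.
have [m|w wp cw] := geodesic_cur pp (eq_leq sp).
  by rewrite lp sp; apply: leaf_far.
have sw : size w == n by rewrite wp sp.
by exists (Tuple sw); rewrite /= cw lp.
Qed.

(** Each leaf ends a walk along one of the [k ^ n] words of length [n], and there are [k ^ n]
    leaves. Equality in this count also makes [cur] injective on these words. *)
Lemma leavesE_cur : leaves T = [set cur t | t : n.-tuple 'I_k].
Proof.
apply/eqP; rewrite eqEcard leavesT -[X in X ^ n]card_ord -card_tuple leq_imset_card.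
by rewrite andbT; apply/subsetP => x /leaf_cur[t <-]; apply: imset_f.
Qed.

Lemma cur_full_leaf w : size w = n -> cur w \in leaves T.
Proof.
move/eqP=> sw; rewrite leavesE_cur; apply/imsetP; by exists (Tuple sw).
Qed.

Lemma cur_full_inj u w : size u = n -> size w = n -> cur u = cur w -> u = w.
Proof.
move=> /eqP su /eqP sw uw.
have /imset_injP I : #|[set cur t | t : n.-tuple 'I_k]| == #|{: n.-tuple 'I_k}|.
  by rewrite -leavesE_cur leavesT card_tuple card_ord.
by have /(congr1 val) := I (Tuple su) (Tuple sw) isT isT uw.
Qed.

Lemma reach_extend u w : size (u ++ w) <= n -> reach (cur w) (cur (u ++ w)) (size u).
Proof.
elim: u => [|i u IH] /= s; first by exists [::].
by rewrite -addn1; apply: reach_cat (IH (ltnW s)) (reach1 (adj_cur _ s)).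
Qed.

(** Extended to length [n], the word [w] leads to a leaf; a shortcut to [cur w] would bring this
    leaf closer than [n]. *)
Lemma cur_far w m : size w <= n -> reach r (cur w) m -> size w <= m.
Proof.
move=> sw rm; pose u := nseq (n - size w) (Ordinal (ltnW k1)).
have su : size (u ++ w) = n by rewrite size_cat size_nseq subnK.
have := leaf_far (cur_full_leaf su) (reach_cat rm (reach_extend (eq_leq su))).
by rewrite -su size_cat addnC leq_add2r.
Qed.

(** Words with the same end have the same length, the distance from the root. Below length [n], the
    tails agree by induction once their ends do, and then the first letters index distinct
    children. *)
Lemma cur_inj u w : size u <= n -> size w <= n -> cur u = cur w -> u = w.
Proof.
have [m] := ubnP (size u); elim: m u w => // m IH u w um su sw uw.
have suw : size u = size w.
  apply/eqP; rewrite eqn_leq; apply/andP; split.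
    by apply: cur_far su _; rewrite uw; exact: cur_reach.
  by apply: cur_far sw _; rewrite -uw; exact: cur_reach.
have [un|un] := eqVneq (size u) n; first by apply: cur_full_inj; rewrite // -suw.
have {}un : size u < n by rewrite ltn_neqAle un su.
case: u w => [|i u] [|j w] // in um su sw uw suw un *; case: suw => suw.
(* Otherwise the end of the second tail would be a child of the common end, hence farther from the
   root than its own word allows. *)
have uw' : cur u = cur w.
  apply/eqP/contraT => ne.
  have [|a ca] := @childs_cur (i :: u) (cur w) un.
    rewrite inE uw par_behead /= [in _ != _]eq_sym ne andbT adj_sym.
    exact: adj_cur.
  have : size (a :: i :: u) <= size w.
    by apply: cur_far => //; rewrite ca; apply: cur_reach; apply: ltnW.
  by rewrite /= suw ltnNge leqnSn.
have {uw'} uw' : u = w by apply: IH => //; exact: ltnW.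
rewrite -uw' in uw *; congr (_ :: _).
(* With exactly [k] children every letter is a valid index, so the default of [nth] never occurs. *)
have ck : #|childs (par u) (cur u)| = k.
  case: u => [|a u] in um su sw uw suw un uw' *; first exact: card_childs_root.
  apply: card_childs; [exact: cur_nleaf| |by apply: adj_par => //; exact: ltnW].
  apply/eqP => cr; have : size (a :: u) <= 0.
    by apply: cur_far; [exact: ltnW|exists [::]].
  by [].
have lt (l : 'I_k) : l < size (enum (childs (par u) (cur u))) by rewrite -cardE ck.
move: uw; rewrite !cur_cons /= (set_nth_default (cur u)) // => /eqP.
rewrite [X in _ == X](set_nth_default (cur u)) // nth_uniq ?enum_uniq //.
by move/eqP/val_inj.
Qed.

(** A neighbour is the predecessor or a child; at length [n] the vertex is a leaf, whose only
    neighbour is the predecessor. *)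
Lemma nbr_cur w y : size w <= n -> adj (cur w) y ->
  exists2 v, size v <= n & cur v = y /\ wparent w v || wparent v w.
Proof.
move=> sw wy; have [yp|yp] := eqVneq y (par w).
  exists (behead w); first by rewrite size_behead; apply: leq_trans (leq_pred _) sw.
  rewrite -par_behead yp /wparent eqxx andbT; split=> //; apply/orP; right.
  by apply/eqP => w0; rewrite yp w0 adj_irr in wy.
have [wn|nw] := ltnP (size w) n.
  have [|i iy] := @childs_cur w y wn; first by rewrite inE wy.
  by exists (i :: w) => //; rewrite /wparent /= eqxx.
have wn : size w = n by apply/eqP; rewrite eqn_leq sw.
have := cur_full_leaf wn; rewrite inE => deg1.
have w0 : w != [::].
  by apply/eqP => w0; move: deg1; rewrite w0 degr gtn_eqF.
case/cards1P: deg1 => z nz; case/eqP: yp.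
have : y \in [set z] by rewrite -nz inE.
have : par w \in [set z] by rewrite -nz inE adj_par.
by rewrite !inE => /eqP -> /eqP ->.
Qed.

Lemma adj_curE u w : size u <= n -> size w <= n ->
  adj (cur u) (cur w) = wparent u w || wparent w u.
Proof.
move=> su sw; apply/idP/idP => [/nbr_cur[] // v sv [vw]|].
  by rewrite (cur_inj sv sw vw).
have P v v' : size v' <= n -> wparent v v' -> adj (cur v) (cur v').
  by case: v' => [|i v'] //= s /andP[_ /eqP <-]; exact: adj_cur.
by case/orP=> [/(P _ _ sw) //|/(P _ _ su)]; rewrite adj_sym.
Qed.

Lemma cur_surj y : exists2 w, size w <= n & cur w = y.
Proof.
have /connectP[p + ->] := conn r y.
elim/last_ind: p => [|q z IH]; first by exists [::].
rewrite rcons_path last_rcons => /andP[/IH[w sw <-] /nbr_cur[] // v sv [<- _]].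
by exists v.
Qed.

Lemma perfect_tree_iso : exists f : ktree k n -> T,
  [/\ bijective f, f (kroot k n) = r & forall x y, adj (f x) (f y) = kadj x y].
Proof.
exists (fun x => cur (kword x)); split=> [||x y].
- apply: inj_card_bij => [x y /cur_inj xy|].
    by apply: kword_inj; apply: xy; exact: size_kword.
  have sub : [set: T] \subset [set cur (kword x) | x in [set: ktree k n]].
    apply/subsetP=> y _; apply/imsetP.
    have [w /kword_surj[x <-] <-] := cur_surj y; by exists x.
  by have := leq_trans (subset_leq_card sub) (leq_imset_card _ _); rewrite !cardsT.
- by have /eqP -> : kword (kroot k n) == [::] by rewrite kword_nil.
- by rewrite kadjE adj_curE ?size_kword.
Qed.

End PerfectTree.

(** * Sums and permutations over finite types *)

Section Sums.
Variable I : finType.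

Lemma sum_neq (A : {set I}) i0 : \sum_(i in A) (i != i0) = #|A :\ i0|.
Proof.
rewrite -sum1_card big_mkcond [RHS]big_mkcond; apply: eq_bigr => i _.
by rewrite !inE andbC; case: ifP => //= _; case: eqP.
Qed.

Lemma sum_pred1 (A : {set I}) i0 : \sum_(i in A) (i == i0) = (i0 \in A).
Proof.
case: (boolP (i0 \in A)) => i0A.
  by rewrite (bigD1 i0) //= eqxx big1 // => i /andP[_ /negbTE ->].
by rewrite big1 // => i iA; case: eqP iA i0A => // -> ->.
Qed.

(** All terms but at most one exceed [m]. This serves for the branches at a rigid vertex when a
    single isomorphism type attains the minimal cost. *)
Lemma leq_sum_but_one (F : I -> nat) m :
  (forall i, m <= F i) -> (forall i j, F i = m -> F j = m -> i = j) ->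
  #|I| * m + #|I|.-1 <= \sum_i F i.
Proof.
move=> mF Fm.
apply: (@leq_trans (\sum_i (m + (F i != m)))); last first.
  by apply: leq_sum => i _; have := mF i; case: eqP; lia.
rewrite big_split sum_nat_const leq_add2l.
case: (pickP (fun i => F i == m)) => [i0 /eqP Fi0|H].
  rewrite (eq_bigr (fun i => (i != i0) : nat)) => [|i _]; last first.
    by congr (nat_of_bool (~~ _)); apply/eqP/eqP => [Fi|-> //]; exact: Fm.
  have := sum_neq [set: I] i0; have := cardsD1 i0 [set: I].
  rewrite cardsT inE => -> /= <-.
  by rewrite (eq_bigl predT) // => i; rewrite inE.
rewrite (eq_bigr (fun=> 1)) => [|i _]; last by rewrite H.
by rewrite sum1_card leq_pred.
Qed.
End Sums.

(** An injective self-map of a finite type is a permutation; this gives the matching of branches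
    that [ciso_nodeP] asks for. *)
Lemma perm_of_codom (I : finType) (D : eqType) (u v : I -> D) :
  injective u -> (forall i, exists j, u i = v j) ->
  exists p : {perm I}, forall i, u i = v (p i).
Proof.
move=> uI /fin_all_exists[q qE].
have qI : injective q by move=> i j ij; apply: uI; rewrite !qE ij.
by exists (perm qI) => i; rewrite permE.
Qed.

(** * Lower bounds on the cost of rigid colorings, and uniqueness of the cheapest *)

Section LowerBounds.
Variable k : nat.
Hypothesis k1 : 1 < k.

(** Two leaves of one color with the same parent could be exchanged. *)
Lemma rigid_color_inj (C : eqType) (c : ktree k 1 -> C) : rigid c ->
  injective (fun i => c (Some (i, tt))).
Proof. by case/rigid_nodeP=> _ nb i j ij; apply/nb/ciso0. Qed.

Lemma rigid_leaf_sum (C : eqType) (a : C) (c : ktree k 1 -> C) : rigid c ->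
  k.-1 <= \sum_(i < k) cost a (branch c i).
Proof.
move=> /rigid_color_inj cI.
have := @leq_sum_but_one _ (fun i => cost a (branch c i)) 0.
rewrite card_ord muln0; apply=> // i j; rewrite !cost0.
by case: eqP => // ci _; case: eqP => // cj _; apply: cI; exact: etrans ci (esym cj).
Qed.

Lemma cost_lower (C : eqType) (a : C) h (c : ktree k h.+1 -> C) : rigid c ->
  k ^ h * k.-1 <= cost a c.
Proof.
elim: h c => [|h IH] c rc; rewrite cost_node; apply: leq_trans (leq_addl _ _).
  by rewrite mul1n; exact: rigid_leaf_sum.
rewrite expnS -mulnA -[X in X * _]card_ord -sum_nat_const leq_sum // => i _.
by apply: IH; case/rigid_nodeP: rc.
Qed.

(** By induction, branches with the same root color are isomorphic, so the [k] branch roots carry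
    each of the [k] colors once, in both colorings; match them by color. *)
Lemma ciso_kcolor h (c c' : ktree k h -> 'I_k) : rigid c -> rigid c' ->
  c (kroot k h) = c' (kroot k h) -> ciso c c'.
Proof.
elim: h c c' => [|h IH] c c'; first by move=> _ _; exact: ciso0.
move=> /rigid_nodeP[rb nb] /rigid_nodeP[rb' nb'] cc'.
apply/ciso_nodeP; split=> //.
pose u (d : ktree k h.+1 -> 'I_k) i := branch d i (kroot k h).
have uI : injective (u c) by move=> i j /(IH _ _ (rb i) (rb j))/nb.
have uI' : injective (u c') by move=> i j /(IH _ _ (rb' i) (rb' j))/nb'.
have [|p pE] := perm_of_codom uI (v := u c').
  by move=> i; exists (invF uI' (u c i)); rewrite f_invF.
by exists p => i; apply: IH (pE i).
Qed.

(** Exactly one branch root has color [a]. So the cost [e h] outside the root satisfies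
    [e (h + 1) = k * e h + (k - 1)] with [e 0 = 0], whence [e h = k ^ h - 1]. *)
Lemma cost_kcolor a h (c : ktree k h -> 'I_k) : rigid c ->
  cost a c = k ^ h - 1 + (c (kroot k h) != a).
Proof.
elim: h c => [|h IH] c; first by rewrite cost0.
move=> rc; have /rigid_nodeP[rb nb] := rc.
pose u i := branch c i (kroot k h).
have uI : injective u.
  by move=> i j ij; apply: nb; apply: ciso_kcolor.
rewrite cost_node addnC; congr (_ + _).
rewrite (eq_bigr (fun i => k ^ h - 1 + (u i != a))) => [|i _]; last exact: IH.
rewrite big_split sum_nat_const card_ord /=.
have := sum_neq [set: 'I_k] a; rewrite (reindex_inj uI) /=.
rewrite (eq_bigl predT) => [->|i]; last by rewrite inE.
have := cardsD1 a [set: 'I_k]; rewrite cardsT inE card_ord => kE.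
have : 0 < k ^ h by rewrite expn_gt0 ltnW.
rewrite expnS mulnBr muln1 => /(leq_pmulr k); rewrite /= add1n in kE.
move: (k * _) kE => x; move: #|_| => y; lia.
Qed.

(** Together with the root color, this set classifies the rigid colorings at height 1 up to
    isomorphism. *)
Definition leaf_colors (C : finType) (c : ktree k 1 -> C) :=
  [set c (Some (i, tt)) | i : 'I_k].

Lemma card_leaf_colors (C : finType) (c : ktree k 1 -> C) : rigid c -> #|leaf_colors c| = k.
Proof. by move=> /rigid_color_inj cI; rewrite card_imset // card_ord. Qed.

Lemma ciso_leaf_colors (C : finType) (c c' : ktree k 1 -> C) : rigid c ->
  c None = c' None -> leaf_colors c = leaf_colors c' -> ciso c c'.
Proof.
move=> /rigid_color_inj cI c0 cc'; apply/ciso_nodeP; split=> //.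
have [|p pE] := perm_of_codom cI (v := fun i => c' (Some (i, tt))).
  move=> i; have : c (Some (i, tt)) \in leaf_colors c' by rewrite -cc' imset_f.
  by case/imsetP=> j _ ->; exists j.
by exists p => i; apply: ciso0; exact: pE.
Qed.

(** The leaves alone cost at least [k.-1], so the root must be free; if no leaf had color [a], all
    [k] of them would count. *)
Lemma min_cost1 (C : finType) (a : C) (c : ktree k 1 -> C) : rigid c -> cost a c = k.-1 ->
  c None = a /\ a \in leaf_colors c.
Proof.
move=> rc; have := rigid_leaf_sum a rc; rewrite cost_node.
case: eqP => [c0|_]; last by lia.
move=> _; rewrite add0n => sE; split=> //; apply: contraT => na.
suff : \sum_(i < k) cost a (branch c i) = k by lia.
rewrite (eq_bigr (fun=> 1)) => [|i _]; first by rewrite sum1_card card_ord.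
rewrite cost0; case: eqP => // ca; case/negP: na.
by rewrite -ca; exact: imset_f.
Qed.

Lemma min_cost2 (C : finType) (a : C) (c : ktree k 2 -> C) : rigid c ->
  cost a c = k * k.-1 -> c None = a /\ forall i, cost a (branch c i) = k.-1.
Proof.
move=> /rigid_nodeP[rb _].
have lb i : k.-1 <= cost a (branch c i).
  by have := cost_lower a (rb i); rewrite mul1n.
(* The excesses over the minimal cost of each branch must all vanish. *)
have : \sum_(i < k) cost a (branch c i) = k * k.-1 + \sum_(i < k) (cost a (branch c i) - k.-1).
  rewrite -[X in X * _]card_ord -sum_nat_const -big_split /=.
  by apply: eq_bigr => i _; rewrite subnKC.
rewrite cost_node => ->; case: eqP => [c0|_] E; last by lia.
split=> // i; have {}E : \sum_(i < k) (cost a (branch c i) - k.-1) = 0 by lia.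
move/eqP: E; rewrite sum_nat_eq0 => /forallP/(_ i); rewrite subn_eq0 => ci.
by apply/eqP; rewrite eqn_leq lb andbT.
Qed.

(** A branch of minimal cost has root color [a], and its leaves omit a single color, other than [a]:
    this leaves [k] types. A rigid vertex has [k] distinct branches, hence uses each type once. *)
Lemma min_cost2_uniq (a : 'I_k.+1) (c c' : ktree k 2 -> 'I_k.+1) : rigid c -> rigid c' ->
  cost a c = k * k.-1 -> cost a c' = k * k.-1 -> ciso c c'.
Proof.
(* The possible sets of leaf colors of a minimal branch. *)
pose F := [set ~: [set x] | x in ~: [set a]].
pose S (d : ktree k 2 -> 'I_k.+1) i := leaf_colors (branch d i).
have cF : #|F| <= k by rewrite (leq_trans (leq_imset_card _ _)) // cardsC1 card_ord.
have SP (d : ktree k 2 -> _) : rigid d -> cost a d = k * k.-1 ->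
  [/\ d None = a, forall i, branch d i None = a, injective (S d) & S d @: setT = F].
  move=> rd /(min_cost2 rd)[d0 db]; have /rigid_nodeP[rb nb] := rd.
  have d1 i := min_cost1 (rb i) (db i).
  have SI : injective (S d).
    move=> i j ij; apply/nb/ciso_leaf_colors => //.
    by case: (d1 i) (d1 j) => -> _ [-> _].
  split=> // [i|]; first by case: (d1 i).
  apply/eqP; rewrite eqEcard card_imset // cardsT card_ord cF andbT.
  apply/subsetP=> _ /imsetP[i _ ->].
  have /cards1P[x xE] : #|~: S d i| == 1.
    by have := cardsC (S d i); rewrite card_leaf_colors // card_ord; lia.
  apply/imsetP; exists x; last by rewrite -xE setCK.
  rewrite !inE; apply: contraTneq (proj2 (d1 i)) => <-.
  by rewrite -[_ \in _]negbK -in_setC -/(S d i) xE inE eqxx.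
move=> rc rc' /(SP _ rc)[c0 cb cI cS] /(SP _ rc')[c0' cb' cI' cS'].
apply/ciso_nodeP; split; first by rewrite c0 c0'.
have [|p pE] := perm_of_codom cI (v := S c').
  move=> i; have : S c i \in F by rewrite -cS imset_f.
  by rewrite -cS' => /imsetP[j _ ->]; exists j.
exists p => i; apply: ciso_leaf_colors (pE i).
  by case/rigid_nodeP: rc.
by rewrite cb cb'.
Qed.

(** At height 3, only one branch can cost [k * k.-1], by [min_cost2_uniq]. This gives [k * (k *
    k.-1) + k.-1 = k.-1 * (k ^ 2 + 1)], multiplied by [k] at each further height. *)
Lemma cost_lower_succ (a : 'I_k.+1) h (c : ktree k h.+3 -> 'I_k.+1) : rigid c ->
  k.-1 * (k ^ 2 + 1) * k ^ h <= cost a c.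
Proof.
elim: h c => [|h IH] c rc; rewrite cost_node; apply: leq_trans (leq_addl _ _);
  have /rigid_nodeP[rb nb] := rc.
  have := @leq_sum_but_one _ (fun i => cost a (branch c i)) (k * k.-1).
  rewrite card_ord => H; apply: leq_trans (H _ _).
  - move: (k.-1) => x; rewrite expnS expn1 expn0; nia.
  - by move=> i; have := cost_lower a (rb i); rewrite expn1.
  - by move=> i j ci cj; apply: nb; exact: min_cost2_uniq ci cj.
rewrite (expnS k h) mulnCA -[X in X * _]card_ord -sum_nat_const leq_sum // => i _.
exact: IH.
Qed.

End LowerBounds.

(** * Families of rigid, pairwise non-isomorphic colorings *)

Lemma ordS_neq m (j : 'I_m.+2) : ordS j != j.
Proof.
rewrite -val_eqE /=; case: (ltnP j m.+1) => jm.
  by rewrite modn_small ?ltnS //; lia.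
have -> : j = m.+1 :> nat by have := ltn_ord j; lia.
by rewrite modnn.
Qed.

Lemma ordSS_neq m (j : 'I_m.+3) : ordS (ordS j) != j.
Proof.
rewrite -val_eqE /= -addn1 modnDml addn1; case: (ltnP j m.+1) => jm.
  by rewrite modn_small //; lia.
have [->|->] : j = m.+1 :> nat \/ j = m.+2 :> nat by have := ltn_ord j; lia.
  by rewrite modnn.
by rewrite -add1n addnC modnDl modn_small.
Qed.

Section Families.
Variables (k : nat) (C : eqType).

(** By [rigid_nodeP], any [k] distinct members of such a family can hang together below one
    vertex. *)
Definition independent (I : Type) h (F : I -> ktree k h -> C) :=
  (forall i, rigid (F i)) /\ forall i j, ciso (F i) (F j) -> i = j.

Definition knode h (a : C) (cs : 'I_k -> ktree k h -> C) : ktree k h.+1 -> C :=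
  fun x => if x is Some (i, y) then cs i y else a.

Lemma independent_leaves (I : Type) (g : I -> C) :
  injective g -> independent (fun i (_ : ktree k 0) => g i).
Proof. by move=> gI; split=> [i|i j /ciso_root /gI //]; exact: rigid0. Qed.

(** Hang the [k] types of [A j] below a root of color [a j]: an isomorphism preserves the root color
    and the set of types, so distinct pairs give distinct types. *)
Lemma independent_node (I : finType) (J : Type) h (F : I -> ktree k h -> C)
    (A : J -> {set I}) (a : J -> C) :
  independent F -> (forall j, #|A j| = k) ->
  (forall i j, a i = a j -> A i = A j -> i = j) ->
  exists G : J -> ktree k h.+1 -> C, independent G /\
    forall b j, cost b (G j) = (a j != b) + \sum_(i in A j) cost b (F i).
Proof.
move=> [rF nF] cA aA.
pose e j (i : 'I_k) := enum_val (cast_ord (esym (cA j)) i).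
have eI j : injective (e j) by move=> x y /enum_val_inj/cast_ord_inj.
have eA j i : e j i \in A j by exact: enum_valP.
have Ae j : A j = [set e j i | i : 'I_k].
  apply/esym/eqP; rewrite eqEcard card_imset // cA card_ord leqnn andbT.
  by apply/subsetP=> _ /imsetP[i _ ->].
exists (fun j => knode (a j) (fun i => F (e j i))); split; last first.
  move=> b j; rewrite cost_node Ae big_imset //=; exact: in2W (eI j).
split=> [j|j j'].
  by apply/rigid_nodeP; split=> [i|i i' /nF /eI //]; exact: rF.
move=> /ciso_nodeP[/= jj' [p pE]]; apply: aA => //.
apply/eqP; rewrite eqEcard !cA leqnn andbT; apply/subsetP=> x.
by rewrite Ae => /imsetP[i _ ->]; rewrite (nF _ _ (pE i)).
Qed.

Lemma independent_succ h e (a0 : C) (F : 'I_k.+1 -> ktree k h -> C) :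
  independent F -> (forall j, cost a0 (F j) = e) ->
  exists G : 'I_k.+1 -> ktree k h.+1 -> C,
    independent G /\ forall j, cost a0 (G j) = k * e.
Proof.
move=> iF cF; have cA (j : 'I_k.+1) : #|~: [set j]| = k by rewrite cardsC1 card_ord.
have [|G [iG cG]] := @independent_node _ _ _ F (fun j => ~: [set j]) (fun=> a0) iF cA.
  by move=> i j _ /setC_inj/set1_inj.
exists G; split=> // j; rewrite cG eqxx (eq_bigr (fun=> e)) => [|i _]; last exact: cF.
by rewrite sum_nat_const cA.
Qed.

Lemma independent_iter m h e (a0 : C) (F : 'I_k.+1 -> ktree k h -> C) :
  independent F -> (forall j, cost a0 (F j) = e) ->
  exists G : 'I_k.+1 -> ktree k (m + h) -> C,
    independent G /\ forall j, cost a0 (G j) = k ^ m * e.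
Proof.
move=> iF cF; elim: m => [|m [G [iG cG]]].
  by exists F; split=> // j; rewrite mul1n.
have [G' [iG' cG']] := independent_succ iG cG.
by exists G'; split=> // j; rewrite cG' expnS mulnA.
Qed.

Hypothesis k1 : 1 < k.

(** Each new type keeps the cheap member and omits two of the [k + 1] others, consecutive in cyclic
    order. This attains the bound of [leq_sum_but_one]. *)
Lemma independent_select h e (a0 : C) (F : 'I_k.+2 -> ktree k h -> C) :
  independent F -> (forall j, cost a0 (F j) = e + (j != ord0)) ->
  exists G : 'I_k.+1 -> ktree k h.+1 -> C,
    independent G /\ forall j, cost a0 (G j) = k * e + k.-1.
Proof.
move=> iF cF.
pose A (j : 'I_k.+1) := ~: [set lift ord0 j; lift ord0 (ordS j)].
have k2 : k = k.-2.+2 by lia.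
have jS (j : 'I_k.+1) : ordS j != j by rewrite k2 in j *; exact: ordS_neq.
have jSS (j : 'I_k.+1) : ordS (ordS j) != j by rewrite k2 in j *; exact: ordSS_neq.
have cA j : #|A j| = k.
  have := cardsC [set lift ord0 j; lift ord0 (ordS j)].
  by rewrite cards2 (inj_eq lift_inj) eq_sym jS card_ord /A; lia.
have [|G [iG cG]] := @independent_node _ _ _ F A (fun=> a0) iF cA.
  move=> i j _ /setC_inj ij.
  have : lift ord0 i \in [set lift ord0 j; lift ord0 (ordS j)] by rewrite -ij set21.
  have : lift ord0 (ordS i) \in [set lift ord0 j; lift ord0 (ordS j)].
    by rewrite -ij set22.
  (* Two distinct indices could give the same pair only if two cyclic steps came back to the start,
     which [k + 1 >= 3] excludes. *)
  rewrite !inE !(inj_eq lift_inj) => /orP[] /eqP Si /orP[] /eqP ii //.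
    by move: (jSS j); rewrite -ii Si eqxx.
  by apply: (can_inj (@ordSK _)).
exists G; split=> // j; rewrite cG eqxx (eq_bigr (fun i => e + (i != ord0))) //.
rewrite big_split sum_nat_const cA sum_neq /=.
have := cardsD1 ord0 (A j); rewrite cA !inE !(eq_sym ord0) -!val_eqE /=.
by lia.
Qed.

End Families.

(** * Colorings that attain the lower bounds *)

Section Constructions.
Variable k : nat.
Hypothesis k1 : 1 < k.

(** At each height there are [k] types, one for each root color, all with the same [k] types as
    branches. The one with root color [a] is the cheapest. *)
Lemma exists_kcolor (a : 'I_k) h : exists2 c : ktree k h -> 'I_k,
  rigid c & cost a c = k ^ h - 1.
Proof.
have [F [rF nF]] : exists F : 'I_k -> ktree k h -> 'I_k, independent F.
  elim: h => [|h [F iF]].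
    by exists (fun i _ => i); apply: independent_leaves.
  have cA : #|[set: 'I_k]| = k by rewrite cardsT card_ord.
  have [|G [iG _]] := @independent_node _ _ _ _ _ F (fun=> setT) id iF (fun=> cA).
    by [].
  by exists G.
have rI : injective (fun i => F i (kroot k h)).
  by move=> i j ij; apply/nF/ciso_kcolor.
by exists (F (invF rI a)) => //; rewrite (cost_kcolor k1) // (f_invF rI) eqxx addn0.
Qed.

(* With k + 2 colors, the parents of the leaves can avoid all repetitions while
   using the cheap color on exactly one leaf each. *)
Lemma exists_many_colors d h : k.+2 <= d -> exists (a : 'I_d) (c : ktree k h.+1 -> 'I_d),
  rigid c /\ cost a c = k ^ h * k.-1.
Proof.
move=> kd; pose g := widen_ord kd; exists (g ord0).
have gI : injective g by move=> i j /(congr1 val) /= /val_inj.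
(* The starting family consists of single vertices in [k + 2] colors, where only the color [g ord0]
   is free. *)
have [|F [iF cF]] := independent_select k1 (e := 0) (a0 := g ord0) (independent_leaves k gI).
  by move=> j; rewrite cost0 (inj_eq gI).
have [G [[rG _] cG]] := independent_iter h iF cF.
rewrite addn1 in G rG cG; rewrite muln0 in cG.
by exists (G ord0).
Qed.

(** The [j]-th type has root color [ord0] and omits the color [j] at its leaves; omitting the free
    color [ord0] costs one more. *)
Lemma independent_succ1 : exists F : 'I_k.+1 -> ktree k 1 -> 'I_k.+1,
  independent F /\ forall j, cost ord0 (F j) = k.-1 + (j == ord0).
Proof.
have cA (j : 'I_k.+1) : #|~: [set j]| = k by rewrite cardsC1 card_ord.
have iL := independent_leaves k (@inj_id 'I_k.+1).
have [|G [iG cG]] := independent_node (A := fun j => ~: [set j]) (a := fun=> ord0) iL cA.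
  by move=> i j _ /setC_inj/set1_inj.
exists G; split=> // j; rewrite cG eqxx.
rewrite (eq_bigr (fun i => i != ord0 : nat)) => [|i _]; last by rewrite cost0.
rewrite sum_neq; have := cardsD1 ord0 (~: [set j]); rewrite cA !inE (eq_sym ord0).
by case: eqP => _ /=; lia.
Qed.

(** For [j != ord_max], the branches are the [k] minimal types and the root has color [j], free only
    for [j = ord0]. The last type has a free root and the dearer branch in place of a minimal one.
    So one type is minimal and [k + 1] types cost one more, as [independent_select] requires. *)
Lemma independent_succ2 : exists F : 'I_k.+2 -> ktree k 2 -> 'I_k.+1,
  independent F /\ forall j, cost ord0 (F j) = k * k.-1 + (j != ord0).
Proof.
have [F [iF cF]] := independent_succ1.
pose A (j : 'I_k.+2) := ~: [set (if j == ord_max then ord_max else ord0 : 'I_k.+1)].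
pose a (j : 'I_k.+2) : 'I_k.+1 := if j == ord_max then ord0 else inord j.
have cA j : #|A j| = k by rewrite cardsC1 card_ord.
have om : (ord_max == ord0 :> 'I_k.+1) = false by rewrite -val_eqE /= gtn_eqF // ltnW.
have lt (j : 'I_k.+2) : j != ord_max -> j < k.+1.
  by rewrite -val_eqE /=; have := ltn_ord j; lia.
have [|G [iG cG]] := independent_node (A := A) (a := a) iF cA.
  move=> i j; rewrite /A /a; case: (eqVneq i) => [->|/lt il]; case: (eqVneq j) => [->|/lt jl] //.
  - by move=> _ /setC_inj/set1_inj/eqP; rewrite om.
  - by move=> _ /setC_inj/set1_inj/eqP; rewrite eq_sym om.
  - by move=> /(congr1 val) /=; rewrite !inordK // => /val_inj.
exists G; split=> // j; rewrite cG (eq_bigr (fun i => k.-1 + (i == ord0))) //.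
rewrite big_split sum_nat_const cA sum_pred1 /= addnC -addnA; congr (_ + _).
rewrite /A /a !inE; case: (eqVneq j) => [->|/lt jl].
  by rewrite eq_sym om eqxx -val_eqE.
by rewrite eqxx -!val_eqE /= inordK.
Qed.

(* The coloring of cost k * k.-1 of the tree of depth 2 is unique up to
   isomorphism, hence the other k.-1 branches of each vertex of height 3 cost one
   more. *)
Lemma exists_succ_color h : exists c : ktree k h.+3 -> 'I_k.+1,
  rigid c /\ cost ord0 c = k.-1 * (k ^ 2 + 1) * k ^ h.
Proof.
have [F [iF cF]] := independent_succ2.
have [G [iG cG]] := independent_select k1 iF cF.
have [H [[rH _] cH]] := independent_iter h iG cG.
rewrite addn3 in H rH cH; exists (H ord0); split=> //.
rewrite cH mulnC; congr (_ * _); rewrite expnS expn1; lia.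
Qed.

Lemma exists_succ_color2 : exists c : ktree k 2 -> 'I_k.+1,
  rigid c /\ cost ord0 c = k * k.-1.
Proof.
have [F [[rF _] cF]] := independent_succ2.
by exists (F ord0); rewrite cF addn0.
Qed.

End Constructions.

(** * Transfer between the perfect tree and the model *)

Lemma automorphism_degree (G : sgraph) (s : {perm G}) x :
  automorphism s -> degree (s x) = degree x.
Proof.
move=> /forallP sA; rewrite /degree -[RHS](card_imset _ (@perm_inj _ s)).
apply: eq_card => y; rewrite inE; apply/idP/imsetP => [xy|[z + ->]].
  exists (s^-1%g y); last by rewrite permKV.
  by rewrite inE -(eqP (forallP (sA _) _)) permKV.
by rewrite inE (eqP (forallP (sA _) _)).
Qed.

(** The [k] leaves below a single vertex of height 1 already need distinct colors. *)
Lemma rigid_card k h (C : finType) (c : ktree k h.+1 -> C) : 0 < k -> rigid c -> k <= #|C|.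
Proof.
move=> k0; elim: h c => [|h IH] c rc.
  by have := leq_card _ (rigid_color_inj rc); rewrite card_ord.
have /rigid_nodeP[rb _] := rc; exact: IH (rb (Ordinal k0)).
Qed.

Section Transfer.
Variables (k n : nat) (T : sgraph) (f : ktree k n -> T).
Hypotheses (fB : bijective f) (fA : forall x y, adj (f x) (f y) = kadj x y).
Hypothesis fR : forall s : {perm T}, automorphism s -> s (f (kroot k n)) = f (kroot k n).

(** Conjugation by [f] exchanges the automorphisms of [T] and of the model; [fR] supplies the fixed
    root that [kaut] demands. *)
Lemma distinguishing_rigid d (c : {ffun T -> 'I_d}) :
  distinguishing c <-> rigid (fun x => c (f x)).
Proof.
case: fB => g fK gK; have fI := can_inj fK; have gI := can_inj gK.
split=> [/forallP dc s [s0 sA] cs|rc]; last apply/forallP => t.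
  have tI : injective (f \o s \o g).
    by apply: inj_comp gI; apply: inj_comp fI perm_inj.
  have /eqP t1 : perm tI == 1%g.
    apply: (implyP (dc (perm tI))); apply/andP; split.
      apply/forallP=> x; apply/forallP=> y.
      by rewrite !permE /= fA sA -fA !gK.
    by apply/preserves_classesP => x; rewrite permE /= cs gK.
  apply/permP=> x; apply: fI; rewrite perm1.
  by rewrite -[RHS](perm1 (f x)) -t1 permE /= fK.
apply/implyP=> /andP[tA /preserves_classesP tc].
have sI : injective (g \o t \o f).
  by apply: inj_comp fI; apply: inj_comp gI perm_inj.
have s1 : perm sI = 1%g.
  apply: rc => [|x]; last by rewrite permE /= gK tc.
  split=> [|x y]; first by rewrite permE /= fR.
  by rewrite !permE /= -!fA !gK (eqP (forallP (forallP tA _) _)).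
apply/eqP/permP=> y; rewrite perm1 -[y]gK.
by apply: gI; rewrite fK -[RHS](perm1 (g y)) -s1 permE.
Qed.

Lemma card_colorC d (c : {ffun T -> 'I_d}) i :
  #|~: color_class c i| = cost i (fun x => c (f x)).
Proof.
rewrite /cost -(card_imset _ (bij_inj fB)); apply: eq_card => y.
rewrite !inE; apply/idP/imsetP => [cy|[x + ->]]; last by rewrite inE.
by case: fB => g fK gK; exists (g y); rewrite ?inE gK.
Qed.

Lemma transfer_coloring d (c : ktree k n -> 'I_d) : rigid c ->
  exists2 c' : {ffun T -> 'I_d}, distinguishing c' &
    forall i, #|~: color_class c' i| = cost i c.
Proof.
case: (fB) => g fK gK rc; exists [ffun y => c (g y)].
  apply/distinguishing_rigid => s sA sc; apply: rc => // x.
  by have := sc x; rewrite !ffunE !fK.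
move=> i; rewrite card_colorC; apply: eq_card => x.
by rewrite !inE ffunE fK.
Qed.

Lemma paint_cost_eq d e (a : 'I_d) (c : ktree k n -> 'I_d) :
  rigid c -> cost a c = e ->
  (forall (b : 'I_d) (c : ktree k n -> 'I_d), rigid c -> e <= cost b c) ->
  paint_cost T d = e.
Proof.
move=> /transfer_coloring[c' dc' cE] ce lb; rewrite -cE in ce.
apply/eqP; rewrite eqn_leq -{1}ce paint_cost_le //=.
(* The default value of the iterated minimum must satisfy the bound as well. *)
have eT : e <= #|T| by rewrite -ce max_card.
rewrite /paint_cost; elim/big_ind: _ => // [x y|c0 /distinguishing_rigid rc0].
  by rewrite leq_min => ->.
elim/big_ind: _ => // [x y|i _]; first by rewrite leq_min => ->.
by rewrite card_colorC; exact: lb.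
Qed.

End Transfer.

(** The root is the only vertex of degree [k], since leaves have degree [1 < k] and the others
    [k + 1]; hence every automorphism fixes it. *)
Lemma perfect_tree_model k n (T : sgraph) : 1 < k -> perfect_tree k n T ->
  exists f : ktree k n -> T,
    [/\ bijective f, forall x y, adj (f x) (f y) = kadj x y
      & forall s : {perm T}, automorphism s -> s (f (kroot k n)) = f (kroot k n)].
Proof.
move=> k1 [conn _ cardL [r [dr dist deg]]].
have [f [fB fr fA]] := perfect_tree_iso k1 conn cardL dr dist deg.
exists f; split=> // s /automorphism_degree sd; rewrite fr; apply/eqP.
apply: contraT => sr; have := sd r; rewrite dr.
have [|/(deg _ sr) ->] := boolP (s r \in leaves T); last by lia.
by rewrite inE => /eqP ->; lia.
Qed.

Lemma map_nseq_in (S U : eqType) (g : S -> U) s y :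
  {in s, forall x, g x = y} -> map g s = nseq (size s) y.
Proof.
elim: s => //= x s IH gy; rewrite gy ?mem_head // IH // => z zs.
by apply: gy; rewrite inE zs orbT.
Qed.

(** * Distinguishing number, paint costs and fixing number of the perfect tree *)

Section Spectrum.
Variables (k m : nat) (T : sgraph).
Hypotheses (k1 : 1 < k) (hT : perfect_tree k m.+1 T).

Lemma Dist_tree : Dist T = k.
Proof.
have [f [fB fA fR]] := perfect_tree_model k1 hT.
rewrite /Dist; case: ex_minnP => d /existsP[c dc] dmin.
apply/eqP; rewrite eqn_leq; apply/andP; split.
  have [c0 rc0 _] := exists_kcolor k1 (Ordinal (ltnW k1)) m.+1.
  have [c' dc' _] := transfer_coloring fB fA fR rc0.
  by apply: dmin; apply/existsP; exists c'.
have := rigid_card (ltnW k1) (proj1 (distinguishing_rigid fB fA fR c) dc).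
by rewrite card_ord.
Qed.

Lemma paint_cost_Dist : paint_cost T k = k ^ m.+1 - 1.
Proof.
have [f [fB fA fR]] := perfect_tree_model k1 hT.
have [c rc cc] := exists_kcolor k1 (Ordinal (ltnW k1)) m.+1.
by apply: (paint_cost_eq fB fA fR rc cc) => b c' rc'; rewrite cost_kcolor // leq_addr.
Qed.

Lemma paint_cost_many d : k.+2 <= d -> paint_cost T d = k ^ m * k.-1.
Proof.
have [f [fB fA fR]] := perfect_tree_model k1 hT.
move=> /(exists_many_colors k1 m)[a [c [rc cc]]].
by apply: (paint_cost_eq fB fA fR rc cc) => b c' rc'; exact: cost_lower.
Qed.

(** The paint cost with [k + 2] colors bounds it above. Conversely, a fixing set is the complement
    of a color class of some distinguishing coloring, to which [cost_lower] applies. *)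
Lemma Fix_tree : Fix T = k ^ m * k.-1.
Proof.
apply/eqP; rewrite eqn_leq -{1}(paint_cost_many (leqnn _)) Fix_le_paint_cost /=.
have [f [fB fA fR]] := perfect_tree_model k1 hT.
have [S /fixing_set_coloring[c dc cS] <-] := Fix_attained T.
rewrite -[X in _ <= X](congr1 (fun A : {set T} => #|A|) cS) (card_colorC fB).
by apply: cost_lower; exact: (proj1 (distinguishing_rigid fB fA fR c) dc).
Qed.

Lemma Fdist_tree D : k <= D -> paint_cost T D = k ^ m * k.-1 ->
  (forall d, k <= d < D -> paint_cost T d != k ^ m * k.-1) -> Fdist T = D.
Proof.
move=> kD pD nD; rewrite /Fdist; case: ex_minnP => d /andP[].
rewrite Dist_tree Fix_tree => kd /eqP pd dmin; apply/eqP; rewrite eqn_leq dmin.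
  by rewrite leqNgt; apply/negP => dD; have := nD d; rewrite kd dD pd eqxx => /(_ isT).
by rewrite kD pD eqxx.
Qed.

End Spectrum.

Lemma paint_cost_succ2 k (T : sgraph) : 1 < k -> perfect_tree k 2 T ->
  paint_cost T k.+1 = k * k.-1.
Proof.
move=> k1 hT; have [f [fB fA fR]] := perfect_tree_model k1 hT.
have [c [rc cc]] := exists_succ_color2 k1.
by apply: (paint_cost_eq fB fA fR rc cc) => b c' /(cost_lower b); rewrite expn1.
Qed.

Lemma paint_cost_succ3 k m (T : sgraph) : 1 < k -> perfect_tree k m.+3 T ->
  paint_cost T k.+1 = k.-1 * (k ^ 2 + 1) * k ^ m.
Proof.
move=> k1 hT; have [f [fB fA fR]] := perfect_tree_model k1 hT.
have [c [rc cc]] := exists_succ_color k1 m.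
by apply: (paint_cost_eq fB fA fR rc cc) => b c'; exact: cost_lower_succ.
Qed.

(** * Spectrum and ratio for depths 1, 2 and at least 3 *)

Theorem theorem4 (k n : nat) (T : sgraph)
    (hk : (2 <= k)%N) (hn : (1 <= n)%N) (hT : perfect_tree k n T) :
  [/\ n = 1%N ->
        paint_cost_spectrum T = (k, [:: k - 1]%N) /\
        paint_cost_ratio T = 1%R,
      n = 2%N ->
        paint_cost_spectrum T
          = (k, k ^ 2 - 1 :: nseq (k * (k - 1) + 1 - k) (k * (k - 1)))%N /\
        paint_cost_ratio T
          = ((k%:R ^+ 2 - 2%:R * k%:R + 1) / (k%:R ^+ 2 - 2%:R * k%:R + 2%:R))%R
    & (3 <= n)%N ->
        paint_cost_spectrum T
          = (k, [:: k ^ n - 1, (k - 1) * (k ^ 2 + 1) * k ^ (n - 3)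
                  & nseq (k ^ (n - 1) * (k - 1) - k) (k ^ (n - 1) * (k - 1))])%N /\
        paint_cost_ratio T
          = ((k%:R ^+ (n - 1) * (k%:R - 1) - k%:R)
             / (k%:R ^+ (n - 1) * (k%:R - 1) - k%:R + 2%:R))%R].
Proof.
case: n hn hT => [//|m] _ hT.
have DistT := Dist_tree hk hT; have FixT := Fix_tree hk hT.
have costk := paint_cost_Dist hk hT; have costM := paint_cost_many hk hT.
have k1E : ((k - 1)%:R = k%:R - 1 :> rat)%R by rewrite natrB // ltnW.
rewrite /paint_cost_spectrum /paint_cost_ratio DistT FixT -!subn1.
rewrite -!subn1 in costM.
have iota_succ b : k < b -> index_iota k b = k :: index_iota k.+1 b.
  by move=> kb; rewrite /index_iota subnS; case: (b - k) (subn_gt0 k b) => [|j]; rewrite ?kb.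
have iota_succ2 b : k.+1 < b -> index_iota k b = [:: k, k.+1 & index_iota k.+2 b].
  move=> kb; rewrite iota_succ 1?ltnW //; congr (_ :: _).
  by rewrite /index_iota [b - k.+2]subnS; case: (b - k.+1) (subn_gt0 k.+1 b) => [|j]; rewrite ?kb.
have many b : [seq paint_cost T d | d <- index_iota k.+2 b] =
    nseq (b - k.+2) (k ^ m * (k - 1)).
  rewrite -[b - k.+2](size_iota k.+2); apply: map_nseq_in => d.
  by rewrite mem_index_iota => /andP[/costM].
have k_gt1 : (1 < k%:R :> rat)%R by rewrite ltr1n.
split=> [[m0]|[m1]|].
(* Here [Fix T = k - 1], so [d = k] is the only entry and [Fdist T = k]. *)
- rewrite m0 in hT costk costM DistT FixT many *; rewrite mul1n.
  have -> : (k - 1).+2 = k.+1 by lia.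
  split; first by rewrite iota_succ // /index_iota subnn /= costk expn1.
  rewrite (Fdist_tree hk hT (leqnn k)) ?costk; first by rewrite divff // k1E; lra.
    by rewrite expn1 mul1n -subn1.
  by move=> d; case: ltngtP.
(* Here the minimum is first reached at [k + 1], so [Fdist T = k + 1]. *)
- rewrite m1 in hT costk costM DistT FixT many *; rewrite expn1 in costM FixT many *.
  have costS := paint_cost_succ2 hk hT; rewrite -subn1 in costS.
  have kk : k <= k * (k - 1) by rewrite leq_pmulr // subn_gt0.
  split.
    rewrite iota_succ2 ?ltnS //= costk costS many; congr (_, _ :: _).
    have -> : k * (k - 1) + 1 - k = ((k * (k - 1)).+2 - k.+2).+1 by lia.
    by [].
  rewrite (Fdist_tree hk hT (leqnSn k)).
  - rewrite natrM k1E -addn1 natrD; congr (_ / _)%R; ring.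
  - by rewrite expn1 costS subn1.
  - move=> d; rewrite ltnS -eqn_leq => /eqP <-; rewrite costk expn1 -subn1.
    by rewrite -mulnn; nia.
- case: m => [//|[//|m]] in hT costk costM DistT FixT many * => _.
  have costS := paint_cost_succ3 hk hT; rewrite -subn1 in costS.
  rewrite !subSS !subn0.
  have x0 : 0 < k ^ m by rewrite expn_gt0 ltnW.
  have FixE : k ^ m.+2 * (k - 1) = (k - 1) * k ^ 2 * k ^ m.
    by rewrite -[m.+2]addn2 expnD; lia.
  have kF : k < k ^ m.+2 * (k - 1).
    rewrite FixE expnS expn1; nia.
  split.
    rewrite iota_succ2 ?ltnS 1?ltnW //= costk costS many.
    by congr (_, _ :: _ :: nseq _ _); lia.
  (* With [k + 1] colors the cost exceeds [Fix T] by [(k - 1) * k ^ m > 0], hence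
     [Fdist T = k + 2]. *)
  rewrite (@Fdist_tree _ _ _ hk hT k.+2); first last.
  - move=> d /andP[kd]; rewrite ltnS leq_eqVlt -subn1 => /orP[/eqP ->|].
      by rewrite costS FixE; nia.
    rewrite ltnS => dk; have -> : d = k by lia.
    rewrite costk expnSr mulnBr muln1; lia.
  - by rewrite costM // subn1.
  - by rewrite ltnW.
  by rewrite natrM natrX k1E -(addn2 k) natrD; congr (_ / _)%R; ring.
Qed.
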